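(* Let $f:\mathbb{R}^n\to\mathbb{R}$ have a nonempty set of global minimizers $\mathcal{X}^*$, let $x_0\in\mathbb{R}^n$, and let $S=\{x\in\mathbb{R}^n : \mathrm{dist}(x;\mathcal{X}^* )\le \mathrm{dist}(x_0;\mathcal{X}^* )\}$. Assume that $f$ is locally Lipschitz over $S$ and that its inverse condition number satisfies $\bar{\mu}>0$, where $$\bar{\mu}=\inf_{x^*\in\mathcal{X}^*,\ x\in S\setminus\mathcal{X}^*}\ \inf_{u\in\partial^\circ f(x)\setminus\{0\}}\frac{\langle u,x-x^*\rangle}{\|u\|\,\|x-x^*\|}.$$ Let $x^*\in\mathcal{X}^*$ be a minimizer and let $r$ satisfy $0<r\le\min\{\bar{\mu},\tfrac{1}{\sqrt{2}}\}$. Let the sequence $(x_t)$ be generated from $x_0$ as follows: for $t=0,1,2,\dots$, if $0\in\partial^\circ f(x_t)$ then stop; otherwise pick an arbitrary $g_t\in\partial^\circ f(x_t)$, set $$\eta_t=\frac{r\,(1-r^2)^{t/2}\,\|x_0-x^*\|}{\|g_t\|},\qquad x_{t+1}=x_t-\eta_t g_t .$$ Then every generated iterate $x_t$ satisfies $$\|x_t-x^*\|\le (1-r^2)^{t/2}\,\|x_0-x^*\|.$$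
   Context: $\|\cdot\|$ is the Euclidean norm and $\langle\cdot,\cdot\rangle$ the standard inner product on $\mathbb{R}^n$; $\mathrm{dist}(x;X)=\inf_{y\in X}\|x-y\|$. ''Locally Lipschitz over $S$'' means that every point of $S$ has an open neighborhood in $\mathbb{R}^n$ on which $f$ is Lipschitz. For $x\in S$, $\partial^\circ f(x)$ denotes the Clarke (generalized) subdifferential, i.e. $\partial^\circ f(x)=\{u\in\mathbb{R}^n : \langle u,v\rangle\le f^\circ(x;v)\ \forall v\in\mathbb{R}^n\}$ with $f^\circ(x;v)=\limsup_{y\to x,\ \lambda\downarrow 0}\frac{f(y+\lambda v)-f(y)}{\lambda}$. An infimum over an empty set is $+\infty$. *)

(* Defs.v *)
From HB Require Import structures.
From mathcomp Require Import all_boot all_order all_algebra.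
From mathcomp Require Import all_classical all_reals all_analysis.
Import Order.TTheory GRing.Theory Num.Theory numFieldNormedType.Exports.

Set Implicit Arguments.
Unset Strict Implicit.
Unset Printing Implicit Defensive.

Local Open Scope classical_set_scope.
Local Open Scope ring_scope.

(* The library norm of 'rV[R]_n is the sup norm, hence the separate Euclidean
   norm; both induce the same topology, so open, nbhs are the library's. *)

Definition inner (R : realType) (n : nat) (u v : 'rV[R]_n) : R :=
  \sum_(i < n) u ord0 i * v ord0 i.

Definition enorm (R : realType) (n : nat) (u : 'rV[R]_n) : R :=
  Num.sqrt (inner u u).

(* Extended-real valued, so that the distance to the empty set is +oo. *)
Definition edistance (R : realType) (n : nat) (x : 'rV[R]_n)
    (X : set 'rV[R]_n) : \bar R :=
  ereal_inf [set (enorm (x - y))%:E | y in X].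

Definition minimizers (R : realType) (n : nat) (f : 'rV[R]_n -> R) :
    set 'rV[R]_n :=
  [set x | forall y, f x <= f y].

Definition region (R : realType) (n : nat) (f : 'rV[R]_n -> R)
    (x0 : 'rV[R]_n) : set 'rV[R]_n :=
  [set x | (edistance x (minimizers f) <= edistance x0 (minimizers f))%E].

Definition locally_lipschitz_over (R : realType) (n : nat)
    (f : 'rV[R]_n -> R) (S : set 'rV[R]_n) : Prop :=
  forall x, S x ->
    exists U : set 'rV[R]_n, [/\ open U, U x &
      exists L : R, forall y z, U y -> U z ->
        `|f y - f z| <= L * enorm (y - z)].

(* The limsup is over y -> x (with y = x allowed) and lambda -> 0, lambda > 0.
   Being extended-real valued, it is defined for every f and x. *)
Definition clarke_derivative (R : realType) (n : nat) (f : 'rV[R]_n -> R)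
    (x v : 'rV[R]_n) : \bar R :=
  limf_esup (fun p : 'rV[R]_n * R => ((f (p.1 + p.2 *: v) - f p.1) / p.2)%:E)
    (filter_prod (nbhs x) (0 : R)^'+).

Definition clarke_subdiff (R : realType) (n : nat) (f : 'rV[R]_n -> R)
    (x : 'rV[R]_n) : set 'rV[R]_n :=
  [set u | forall v, ((inner u v)%:E <= clarke_derivative f x v)%E].

Definition inverse_condition_number (R : realType) (n : nat)
    (f : 'rV[R]_n -> R) (x0 : 'rV[R]_n) : \bar R :=
  ereal_inf
    [set ereal_inf
       [set (inner u (p.2 - p.1) / (enorm u * enorm (p.2 - p.1)))%:E
         | u in clarke_subdiff f p.2 `\ 0]
     | p in minimizers f `*` (region f x0 `\` minimizers f)].

(* x 0, ..., x T are iterates produced by the method: it has not stopped at any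
   of x 0, ..., x (T - 1).  The values of x beyond T and of g from T on are
   irrelevant, so both terminating and infinite runs are covered by letting T
   vary. *)
Definition subgradient_run (R : realType) (n : nat) (f : 'rV[R]_n -> R)
    (r : R) (x0 xs : 'rV[R]_n) (T : nat) (x g : nat -> 'rV[R]_n) : Prop :=
  x 0%N = x0 /\
  forall t, (t < T)%N ->
    let eta := r * (1 - r ^+ 2) `^ (t%:R / 2) * enorm (x0 - xs) / enorm (g t) in
    [/\ ~ clarke_subdiff f (x t) 0, clarke_subdiff f (x t) (g t) &
        x t.+1 = x t - eta *: g t].

(* Main.v *)
Require Import Defs.
From HB Require Import structures.
From mathcomp Require Import all_boot all_order all_algebra.
From mathcomp Require Import all_classical all_reals all_analysis.
From mathcomp Require Import ring lra.
Import Order.TTheory GRing.Theory Num.Theory numFieldNormedType.Exports.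
Local Open Scope classical_set_scope.
Local Open Scope ring_scope.

(** The classical computation: if [x t] lies in the region and is not a
    minimizer, sharpness of the subgradient along the step gives
      |x_{t+1} - xs|^2 <= d^2 - 2 r s d + s^2
    with [d] the current distance to [xs] and [s = r E] the step length, where
    [d <= E] is the inductive bound.  Since [2 r^2 <= 1], the right-hand side is
    at most [(1 - r^2) E^2] ([run_bound]).

    The catch is that sharpness is only known inside the region, which is
    defined by the distance to the set of minimizers, whereas the induction
    controls the distance to the chosen [xs].  If [xs] is not a nearest
    minimizer to [x0], the steps may be too long to keep the distance to the other
    minimizers under control.  What saves the statement is that a positive
    condition number leaves little freedom to the set of minimizers.

    Let [y] and [z] be minimizers.  At a point [x] close to the open segment
    from [y] to [z], the directions [x - y] and [x - z] are almost opposite, so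
    no nonzero [u] can make an acute angle, bounded away from the right angle, with
    both.  Hence the only subgradient that a nonminimizer can have there is 0
    ([flat_between]), [f] is constant on small balls there
    ([le_center_flat_ball]), and minimality propagates from the end points.
    This gives two facts, when [x0] is not a minimizer.
    - The minimizers form a convex set ([minimizers_convex]).
    - In dimension at least 2 there is only one minimizer: a second one would
      produce a ball of minimizers ([minimizers_ball]); a chord of that ball,
      parallel to the tangent and close to the boundary, makes the neighbourhood
      of the boundary consist of minimizers, so that the radius grows by a fixed
      amount ([minimizers_ball_grow]), and every point, [x0] included, would be
      a minimizer ([minimizers_everywhere]).

    With a single minimizer, the bound on the distance to [xs] is the
    membership in the region.  On the line, the minimizers form an interval, all
    the steps point towards it, and the first one is the longest; if it does not
    land on a minimizer, it is at most the distance from [x0] to the interval,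
    and no later step can overshoot out of the region ([run_line_in_region]).

    Nonzero subgradients are produced by minimizing [f] plus a small smooth
    barrier on a ball where the center is not a minimum
    ([exists_nonzero_subgradient]); continuity of [f] is enough for this. *)

Set Implicit Arguments.
Unset Strict Implicit.
Unset Printing Implicit Defensive.

(** * Euclidean geometry *)

Section Euclidean.
Context {R : realType} {n : nat}.
Implicit Types (u v w x y z : 'rV[R]_n) (a : R).

Lemma innerC u v : inner u v = inner v u.
Proof. by apply: eq_bigr => i _; rewrite mulrC. Qed.

Lemma innerDl u v w : inner (u + v) w = inner u w + inner v w.
Proof. by rewrite -big_split; apply: eq_bigr => i _; rewrite mxE mulrDl. Qed.

Lemma innerZl a u v : inner (a *: u) v = a * inner u v.
Proof.
by rewrite /inner big_distrr; apply: eq_bigr => i _; rewrite mxE -mulrA.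
Qed.

Lemma innerNl u v : inner (- u) v = - inner u v.
Proof. by rewrite -scaleN1r innerZl mulN1r. Qed.

Lemma innerBl u v w : inner (u - v) w = inner u w - inner v w.
Proof. by rewrite innerDl innerNl. Qed.

Lemma innerDr u v w : inner u (v + w) = inner u v + inner u w.
Proof. by rewrite innerC innerDl (innerC v) (innerC w). Qed.

Lemma innerZr a u v : inner u (a *: v) = a * inner u v.
Proof. by rewrite innerC innerZl (innerC v). Qed.

Lemma innerNr u v : inner u (- v) = - inner u v.
Proof. by rewrite innerC innerNl (innerC v). Qed.

Lemma innerBr u v w : inner u (v - w) = inner u v - inner u w.
Proof. by rewrite innerDr innerNr. Qed.

Definition innerE :=
  (innerBl, innerBr, innerDl, innerDr, innerNl, innerNr, innerZl, innerZr).

Lemma inner0l v : inner 0 v = 0.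
Proof. by rewrite -(scale0r 0) innerZl mul0r. Qed.

Lemma inner_ge0 u : 0 <= inner u u.
Proof. by apply: sumr_ge0 => i _; rewrite -expr2 sqr_ge0. Qed.

Lemma enorm_ge0 u : 0 <= enorm u.
Proof. exact: sqrtr_ge0. Qed.

Lemma sqr_enorm u : enorm u ^+ 2 = inner u u.
Proof. by rewrite sqr_sqrtr ?inner_ge0. Qed.

Lemma sqr_enormB u v :
  enorm (u - v) ^+ 2 = enorm u ^+ 2 - 2 * inner v u + enorm v ^+ 2.
Proof. by rewrite !sqr_enorm !innerE (innerC u v); ring. Qed.

Lemma enorm0 : enorm (0 : 'rV[R]_n) = 0.
Proof. by rewrite /enorm inner0l sqrtr0. Qed.

Lemma enorm_eq0 u : (enorm u == 0) = (u == 0).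
Proof.
apply/eqP/eqP => [u0|->]; last exact: enorm0.
have /psumr_eq0P H : inner u u = 0 by rewrite -sqr_enorm u0 expr0n.
apply/rowP => i; rewrite mxE; apply/eqP; rewrite -sqrf_eq0 expr2; apply/eqP.
by apply: H => // j _; rewrite -expr2 sqr_ge0.
Qed.

Lemma enorm_gt0 u : (0 < enorm u) = (u != 0).
Proof. by rewrite lt0r enorm_eq0 enorm_ge0 andbT. Qed.

Lemma enormZ a u : enorm (a *: u) = `|a| * enorm u.
Proof.
by rewrite /enorm innerZl innerZr mulrA -expr2 sqrtrM ?sqr_ge0// sqrtr_sqr.
Qed.

Lemma enormN u : enorm (- u) = enorm u.
Proof. by rewrite -scaleN1r enormZ normrN normr1 mul1r. Qed.

Lemma enormBC u v : enorm (u - v) = enorm (v - u).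
Proof. by rewrite -enormN opprB. Qed.

Lemma Cauchy_Schwarz u v : inner u v <= enorm u * enorm v.
Proof.
have [->|v0] := eqVneq v 0; first by rewrite innerC inner0l enorm0 mulr0.
have v_gt0 : 0 < inner v v by rewrite -sqr_enorm exprn_gt0// enorm_gt0.
apply: le_trans (ler_norm _) _.
rewrite -(@ler_pXn2r _ 2)// ?nnegrE ?mulr_ge0 ?enorm_ge0//.
rewrite real_normK ?num_real// exprMn !sqr_enorm.
have := inner_ge0 (inner v v *: u - inner u v *: v).
rewrite !innerE (innerC v u) => H.
rewrite -subr_ge0 -(pmulr_rge0 _ v_gt0); apply: le_trans H _.
by rewrite le_eqVlt; apply/orP; left; apply/eqP; ring.
Qed.

Lemma enormD u v : enorm (u + v) <= enorm u + enorm v.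
Proof.
rewrite -(@ler_pXn2r _ 2)// ?nnegrE ?addr_ge0 ?enorm_ge0//.
rewrite sqrrD !sqr_enorm !innerE (innerC v u).
by have := Cauchy_Schwarz u v; lra.
Qed.

Lemma enorm_triangle y x z : enorm (x - z) <= enorm (x - y) + enorm (y - z).
Proof. by apply: le_trans _ (enormD _ _); rewrite addrA subrK. Qed.

Lemma coord_le_enorm u i : `|u ord0 i| <= enorm u.
Proof.
rewrite -(@ler_pXn2r _ 2)// ?nnegrE ?enorm_ge0// sqr_enorm.
rewrite real_normK ?num_real// /inner (bigD1 i)//= -expr2 lerDl.
by apply: sumr_ge0 => j _; rewrite -expr2 sqr_ge0.
Qed.

Lemma inner_self_continuous q : continuous (fun x => inner (x - q) (x - q)).
Proof.
apply: continuous_big => [|i _ x]; first exact: add_continuous.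
have H : {for x, continuous (fun y => (y - q) ord0 i)}.
  under [X in {for _, continuous X}]funext => y do rewrite !mxE.
  by apply: continuousB; [exact: coord_continuous|exact: cst_continuous].
exact: (continuousM H H).
Qed.

Lemma enorm_continuous q : continuous (fun x => enorm (x - q)).
Proof.
move=> x; rewrite /enorm.
apply: (@continuous_comp _ _ _ (fun x => inner (x - q) (x - q)) (@Num.sqrt R)).
  exact: inner_self_continuous.
exact: sqrt_continuous.
Qed.

Lemma near_enorm_lt x q a : enorm (x - q) < a ->
  \forall y \near x, enorm (y - q) < a.
Proof.
by move=> xa; exact: (cvgr_lt (enorm (x - q)) (@enorm_continuous q x)).
Qed.

Lemma enorm_ball_nbhs x a : 0 < a -> \forall y \near x, enorm (y - x) < a.
Proof. by move=> a0; apply: near_enorm_lt; rewrite subrr enorm0. Qed.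

Lemma enorm_ball_compact q a : compact [set x : 'rV[R]_n | enorm (x - q) <= a].
Proof.
apply: bounded_closed_compact; last first.
  apply: (@preimage_closed _ _ (fun x : 'rV[R]_n => enorm (x - q))
    [set y | y <= a]).
    by move=> x _; exact: enorm_continuous.
  exact: closed_le.
exists (a + enorm q); split; first exact: num_real.
move=> M aM x /= xa.
have M0 : 0 <= M.
  by have := enorm_ge0 q; have := enorm_ge0 (x - q); lra.
rewrite [leLHS]mx_normrE; apply/bigmax_leP; split=> // -[i j] _ /=.
rewrite ord1; apply: le_trans (coord_le_enorm x j) _.
have := enormD (x - q) q; rewrite subrK; lra.
Qed.

End Euclidean.

(** * Producing Clarke subgradients *)

Section Clarke.
Context {R : realType} {n : nat}.
Implicit Types (f : 'rV[R]_n -> R) (q c u v w x y z : 'rV[R]_n) (a : R).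

(** The Clarke derivative is a limsup over nearby base points, so a lower bound
    on the difference quotients at the single base point [c] bounds it below. *)
Lemma clarke_subdiff_lower f c u :
  (forall v e, 0 < e ->
    \forall l \near (0 : R)^'+, inner u v - e <= (f (c + l *: v) - f c) / l) ->
  clarke_subdiff f c u.
Proof.
move=> H v; apply: le_ereal_inf_tmp => _ [V [[P Q] /= [cP Q0] PQV] <-].
apply/lee_addgt0Pr => e e0.
have [l [Ql le]] : exists l, Q l /\ inner u v - e <= (f (c + l *: v) - f c) / l.
  by apply: (@filter_ex _ (0 : R)^'+); apply: filterI => //; exact: H.
rewrite -leeBlDr// -EFinB.
apply: le_trans (_ : ((f (c + l *: v) - f c) / l)%:E <= _)%E.
  by rewrite lee_fin.
apply: ereal_sup_ubound; exists (c, l) => //; apply: PQV; split => //=.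
exact: nbhs_singleton cP.
Qed.

Lemma clarke_subdiff_minimizer f c : minimizers f c -> clarke_subdiff f c 0.
Proof.
move=> cmin; apply: clarke_subdiff_lower => v e e0.
near=> l; have l0 : 0 < l by near: l; exact: nbhs_right_gt.
rewrite inner0l sub0r (@le_trans _ _ 0)//; first by rewrite oppr_le0 ltW.
by rewrite divr_ge0 ?subr_ge0 ?cmin// ltW.
Unshelve. all: by end_near. Qed.

(** Minimize [f] plus the barrier [K / (d^2 - |x - q|^2)] on the open ball.  At
    a minimizer [c] of the sum, minus the gradient of the barrier is a Clarke
    subgradient of [f]; it vanishes only for [c = q], which is excluded as soon
    as [K] is so small that the sum is already smaller at [x1] than at [q]. *)
Lemma exists_nonzero_subgradient f q d m x1 :
  (forall x, m <= f x) ->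
  (forall x, enorm (x - q) < d -> {for x, continuous f}) ->
  enorm (x1 - q) < d -> f x1 < f q ->
  exists c u, [/\ enorm (c - q) < d, u != 0 & clarke_subdiff f c u].
Proof.
move=> fm cf x1d fx1.
have d0 : 0 < d by apply: le_lt_trans x1d; exact: enorm_ge0.
pose g x := d ^+ 2 - inner (x - q) (x - q).
have g_gt0 x : (0 < g x) = (enorm (x - q) < d).
  by rewrite subr_gt0 -sqr_enorm ltr_pXn2r// nnegrE ?enorm_ge0 ?ltW.
have gq : g q = d ^+ 2 by rewrite /g subrr inner0l subr0.
have gx1 : 0 < g x1 by rewrite g_gt0.
pose K := (f q - f x1) * g x1 / 2.
have K0 : 0 < K by rewrite /K divr_gt0// mulr_gt0// subr_gt0.
pose M := f q - m + K / d ^+ 2.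
have d20 : 0 < d ^+ 2 by rewrite exprn_gt0.
have Kd : 0 < K / d ^+ 2 by rewrite divr_gt0.
have M0 : 0 < M by rewrite /M; have := fm q; lra.
have KM0 : 0 < K / M by rewrite divr_gt0.
have KMd : K / M <= d ^+ 2.
  rewrite ler_pdivrMr// mulrC -ler_pdivrMr// /M; have := fm q; lra.
pose h x := f x + K / g x.
(* [M] is chosen so that a barrier value above [M] makes the sum exceed its
   value at [q]: the minimum is attained on the compact set [A] where the
   barrier is at most [M]. *)
pose A := [set x | enorm (x - q) <= Num.sqrt (d ^+ 2 - K / M)].
have AE x : A x <-> K / M <= g x.
  rewrite /A/= /enorm ler_sqrt ?subr_ge0// /g; split; lra.
have Aq : A q by apply/AE; rewrite gq.
have Ad x : A x -> enorm (x - q) < d.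
  by move/AE => H; rewrite -g_gt0; lra.
have hcont : {within A, continuous h}.
  apply: continuous_in_subspaceT => x; rewrite inE => /Ad xd.
  apply: (@continuousD _ _ _ f (fun x => K / g x)); first exact: cf.
  apply: (@continuousM _ _ (cst K) (fun x => (g x)^-1)).
    exact: cst_continuous.
  apply: continuousV; first by rewrite gt_eqF// g_gt0.
  apply: (@continuousB _ _ _ (cst (d ^+ 2)) (fun x => inner (x - q) (x - q))).
    exact: cst_continuous.
  exact: inner_self_continuous.
have [c] := EVT_min_rV (ex_intro A q Aq) (@enorm_ball_compact _ _ q _) hcont.
rewrite inE => Ac cmin.
have cd := Ad _ Ac.
have {}cmin x : enorm (x - q) < d -> h c <= h x.
  move=> xd; have [Ax|nAx] := pselect (A x); first by apply: cmin; rewrite inE.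
  apply: le_trans (cmin q _) _; first by rewrite inE.
  have gx : 0 < g x by rewrite g_gt0.
  have : M <= K / g x.
    rewrite ler_pdivlMr// mulrC -ler_pdivlMr// leNgt; apply/negP => H.
    by apply: nAx; apply/AE; exact: ltW.
  by rewrite /h gq /M; have := fm x; lra.
have gc : 0 < g c by rewrite g_gt0.
exists c, (- (2 * K / g c ^+ 2) *: (c - q)); split => //.
  rewrite scaler_eq0 negb_or subr_eq0; apply/andP; split.
    by rewrite oppr_eq0 lt0r_neq0// divr_gt0 ?exprn_gt0// mulr_gt0.
  apply: contraTneq fx1 => cq.
  have := cmin _ x1d; rewrite cq /h gq.
  have -> : K / g x1 = (f q - f x1) / 2 by rewrite /K; field; exact: lt0r_neq0.
  by rewrite -leNgt; lra.
apply: clarke_subdiff_lower => v e e0.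
pose a := inner (c - q) v; pose b := inner v v.
(* [F l * l] is the opposite of the increment of the barrier from [c] to
   [c + l *: v]. *)
pose F l := - K * (2 * a + l * b) / ((g c - l * (2 * a) - l * (l * b)) * g c).
have gl l : g (c + l *: v) = g c - l * (2 * a) - l * (l * b).
  rewrite /g /a /b addrAC !innerE (innerC v c) (innerC v q); ring.
have F0 : F 0 = inner (- (2 * K / g c ^+ 2) *: (c - q)) v.
  rewrite /F innerZl -/a !mul0r !subr0 addr0; field; exact: lt0r_neq0.
have Fcvg : F l @[l --> (0 : R)] --> F 0.
  have idc : (fun l : R => l) @ (0 : R) --> (0 : R) by exact: cvg_id.
  apply: cvgM.
    apply: cvgM; first exact: cvg_cst.
    by apply: cvgD; [exact: cvg_cst|apply: cvgM => //; exact: cvg_cst].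
  apply: cvgV; first by rewrite !mul0r !subr0 mulf_neq0// gt_eqF.
  apply: cvgM; last exact: cvg_cst.
  apply: cvgB.
    by apply: cvgB; [exact: cvg_cst|apply: cvgM => //; exact: cvg_cst].
  by apply: cvgM => //; apply: cvgM => //; exact: cvg_cst.
have Glcvg : (g c - l * (2 * a) - l * (l * b)) @[l --> (0 : R)] --> g c.
  have idc : (fun l : R => l) @ (0 : R) --> (0 : R) by exact: cvg_id.
  rewrite -[X in _ --> X](_ : g c - 0 * (2 * a) - 0 * (0 * b) = _); last first.
    by ring.
  apply: cvgB.
    by apply: cvgB; [exact: cvg_cst|apply: cvgM => //; exact: cvg_cst].
  by apply: cvgM => //; apply: cvgM => //; exact: cvg_cst.
near=> l.
have l0 : 0 < l by near: l; exact: nbhs_right_gt.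
have G0 : 0 < g c - l * (2 * a) - l * (l * b).
  by near: l; apply: cvg_within; apply: (cvgr_gt _ Glcvg).
apply: (@le_trans _ _ (F l)).
  apply: ltW; near: l; apply: cvg_within; apply: (cvgr_gt _ Fcvg).
  by rewrite F0; lra.
have cl : enorm (c + l *: v - q) < d by rewrite -g_gt0 gl.
rewrite ler_pdivlMr//.
have := cmin _ cl; rewrite /h gl => H.
have -> : F l * l = K / g c - K / (g c - l * (2 * a) - l * (l * b)).
  rewrite /F; field; apply/andP; split; exact: lt0r_neq0.
lra.
Unshelve. all: by end_near. Qed.

End Clarke.

(** * Balls on which the only subgradient is 0 *)

Section Flat.
Context {R : realType} {n : nat}.
Variable f : 'rV[R]_n -> R.
Implicit Types (p q c u v w x y z : 'rV[R]_n) (a : R).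

Lemma near_ray (c v : 'rV[R]_n) (P : set 'rV[R]_n) :
  nbhs c P -> \forall l \near (0 : R)^'+, P (c + l *: v).
Proof.
move=> cP; apply: cvg_within.
suff H : (c + l *: v) @[l --> (0 : R)] --> c by exact: H.
rewrite -[X in _ --> X](_ : c + 0 *: v = c); last by rewrite scale0r addr0.
by apply: cvgD; [exact: cvg_cst|apply: cvgZ; [exact: cvg_id|exact: cvg_cst]].
Qed.

Lemma ge_limit_ray c v a : {for c, continuous f} ->
  (\forall l \near (0 : R)^'+, a <= f (c + l *: v)) -> a <= f c.
Proof.
move=> cf H; rewrite leNgt; apply/negP => fca.
have /(near_ray v) H' : nbhs c (fun y => f y < a) by exact: (cvgr_lt (f c) cf).
have [l []] : exists l, a <= f (c + l *: v) /\ f (c + l *: v) < a.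
  by apply: (@filter_ex _ (0 : R)^'+); apply: filterI.
by move=> H1 H2; have := le_lt_trans H1 H2; rewrite ltxx.
Qed.

(** If the ball contains no minimizer, a point with a smaller value than the
    center would yield a nonzero subgradient.  Otherwise let [c] be a minimizer
    nearest to [q]: the open ball of radius [|c - q|] contains no minimizer, so
    [f >= f q] on it, and by continuity at its boundary point [c] the minimal
    value is at least [f q]. *)
Lemma le_center_flat_ball p q s :
  minimizers f p ->
  (forall x, enorm (x - q) < s -> {for x, continuous f}) ->
  (forall x u, enorm (x - q) < s -> ~ minimizers f x ->
    clarke_subdiff f x u -> u = 0) ->
  forall x, enorm (x - q) < s -> f q <= f x.
Proof.
move=> pmin cf flat.
have le_ball d : d <= s -> (forall x, enorm (x - q) < d -> ~ minimizers f x) ->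
    forall x, enorm (x - q) < d -> f q <= f x.
  move=> ds nomin x xd; rewrite leNgt; apply/negP => fxq.
  have [|c [u [cd u0 uc]]] := exists_nonzero_subgradient pmin _ xd fxq.
    by move=> y yd; apply: cf; exact: lt_le_trans ds.
  move/eqP: u0; apply; apply: (flat c) => //; first exact: lt_le_trans ds.
  exact: nomin.
have [[m [ms mmin]]|nomin] :=
  pselect (exists m, enorm (m - q) < s /\ minimizers f m); last first.
  by apply: le_ball => // x xs xmin; apply: nomin; exists x.
suff qmin : minimizers f q by move=> x _; exact: qmin.
pose A := [set x : 'rV[R]_n | enorm (x - q) <= enorm (m - q)] `&` minimizers f.
have cA : compact A.
  have AB : A `<=` [set x : 'rV[R]_n | enorm (x - q) <= enorm (m - q)].
    by move=> x [].
  suff Acl : closed A.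
    exact: (subclosed_compact Acl (@enorm_ball_compact _ _ _ _) AB).
  rewrite closedE => x /= Ax; apply: contrapT => nAx; apply: Ax.
  have [xm|mx] := leP (enorm (x - q)) (enorm (m - q)).
    have mx : f m < f x.
      rewrite ltNge; apply/negP => fxm; apply: nAx; split=> // y.
      exact: le_trans fxm (mmin y).
    have : \forall y \near x, f m < f y.
      by apply: (cvgr_gt (f x) (cf x _)) => //; exact: le_lt_trans ms.
    by apply: filterS => y my [_ /(_ m)]; rewrite leNgt my.
  have : \forall y \near x, enorm (m - q) < enorm (y - q).
    by apply: (cvgr_gt (enorm (x - q)) (@enorm_continuous _ _ q x)).
  by apply: filterS => y my [/= ]; rewrite leNgt my.
have A0 : A !=set0 by exists m; split => /=.
have dc : {within A, continuous (fun x => enorm (x - q))}.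
  by apply: continuous_subspaceT; exact: enorm_continuous.
have [c] := EVT_min_rV A0 cA dc.
rewrite inE => -[cm cmin] near_c.
have [cq|] := eqVneq c q; first by rewrite -cq.
rewrite -subr_eq0 -enorm_gt0 => cq0.
have ball_c x : enorm (x - q) < enorm (c - q) -> f q <= f x.
  apply: le_ball => [|y yc ymin].
    by apply: le_trans (ltW ms).
  have /near_c : y \in A.
    by rewrite inE; split => //; exact: le_trans (ltW yc) cm.
  by rewrite leNgt yc.
suff : f q <= f c by move=> qc x; exact: le_trans qc (cmin x).
apply: (@ge_limit_ray c (q - c)); first by apply: cf; exact: le_lt_trans cm ms.
near=> l.
have l0 : 0 < l by near: l; exact: nbhs_right_gt.
have l1 : l < 1 by near: l; exact: nbhs_right_lt.
apply: ball_c.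
have -> : c + l *: (q - c) - q = (1 - l) *: (c - q).
  by apply/rowP => i; rewrite !mxE; ring.
by rewrite enormZ ger0_norm ?subr_ge0 ?ltW// gtr_pMl// ltrBlDr ltrDl.
Unshelve. all: by end_near. Qed.

End Flat.

(** * The set of minimizers of a sharp function *)

Section Sharp.
Context {R : realType} {n : nat}.
Variables (f : 'rV[R]_n -> R) (S : set 'rV[R]_n) (r delta : R).
Hypothesis f_cont : forall x, S x -> {for x, continuous f}.
Hypothesis delta_gt0 : 0 < delta.
Hypothesis near_S : forall x y,
  minimizers f y -> enorm (x - y) < delta -> S x.
Hypothesis r_gt0 : 0 < r.
Hypothesis r_le1 : r <= 1.
Hypothesis sharp : forall x y u, minimizers f y -> S x -> ~ minimizers f x ->
  clarke_subdiff f x u -> u != 0 ->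
  r * (enorm u * enorm (x - y)) <= inner u (x - y).
Implicit Types (p q c u v w x y z : 'rV[R]_n).

(** Add [(1 - t)] times the sharpness inequality for [y] and [t] times the one
    for [y + v].  The left-hand arguments add up to [x - b], where [b] is the
    point [y + t *: v], so Cauchy-Schwarz bounds [r] times a weighted sum of
    the distances to [y] and [y + v] by [|x - b|]: for [u != 0], the point [x]
    cannot be too close to [b].  The larger distance is the one to [y + v], as
    [t <= 1 / 2], so the estimate depends only on [t * |v|], the distance from
    [b] to the nearer end point. *)
Lemma flat_between y v t x u :
  minimizers f y -> minimizers f (y + v) ->
  0 < t -> t <= 1 / 2 -> S x ->
  enorm (x - (y + t *: v)) < r * (t * enorm v) / 2 ->
  ~ minimizers f x -> clarke_subdiff f x u -> u = 0.
Proof.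
move=> ymin zmin t0 t12 Sx xb nx ux; apply/eqP/negPn/negP => u0.
have Hy := sharp ymin Sx nx ux u0; have Hz := sharp zmin Sx nx ux u0.
have := enorm_gt0 u; rewrite u0 => nu.
set b := y + t *: v in xb.
have Dy : t * enorm v - enorm (x - b) <= enorm (x - y).
  have := enorm_triangle x b y; rewrite (enormBC b x).
  have -> : b - y = t *: v by rewrite /b addrC addKr.
  by rewrite enormZ gtr0_norm//; lra.
have Dz : (1 - t) * enorm v - enorm (x - b) <= enorm (x - (y + v)).
  have := enorm_triangle x (y + v) b; rewrite (enormBC (y + v) x).
  have -> : y + v - b = (1 - t) *: v.
    by apply/rowP => i; rewrite !mxE; ring.
  by rewrite enormZ ger0_norm; lra.
have E : inner u (x - b) =
    (1 - t) * inner u (x - y) + t * inner u (x - (y + v)).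
  by rewrite /b !innerE; ring.
have CS := Cauchy_Schwarz u (x - b).
have {}Hy : r * enorm u * (t * enorm v - enorm (x - b)) <= inner u (x - y).
  by apply: le_trans Hy; rewrite mulrA ler_pM2l// mulr_gt0.
have {}Hz : r * enorm u * ((1 - t) * enorm v - enorm (x - b)) <=
    inner u (x - (y + v)).
  by apply: le_trans Hz; rewrite mulrA ler_pM2l// mulr_gt0.
have t1 : 0 <= 1 - t by lra.
have := ler_wpM2l t1 Hy; have := ler_wpM2l (ltW t0) Hz => H1 H2.
have : enorm u * (r * (2 * (t * (1 - t) * enorm v) - enorm (x - b))) <=
    enorm u * enorm (x - b) by lra.
rewrite ler_pM2l// => {}H1.
have V := enorm_ge0 v.
have : t * enorm v <= 2 * (t * (1 - t) * enorm v).
  have : 0 <= t * enorm v * (1 - 2 * t).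
    by apply: mulr_ge0; [rewrite mulr_ge0 ?(ltW t0)|lra].
  lra.
have X := enorm_ge0 (x - b).
have : r * enorm (x - b) <= enorm (x - b) by rewrite ler_piMl.
move=> H3 H4; have := ler_wpM2l (ltW r_gt0) H4; lra.
Qed.

Lemma le_between y v t x :
  minimizers f y -> minimizers f (y + v) ->
  0 < t -> t <= 1 / 2 -> 2 * (t * enorm v) <= delta ->
  forall q s, enorm (q - (y + t *: v)) + s <= r * (t * enorm v) / 2 ->
  enorm (x - q) < s -> f q <= f x.
Proof.
move=> ymin zmin t0 t12 tv q s qs.
have ball w : enorm (w - q) < s ->
    enorm (w - (y + t *: v)) < r * (t * enorm v) / 2.
  by move=> ws; have := enorm_triangle q w (y + t *: v); lra.
have Sball w : enorm (w - q) < s -> S w.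
  move=> /ball wb; apply: (near_S ymin).
  have := enorm_triangle (y + t *: v) w y.
  have -> : y + t *: v - y = t *: v by rewrite addrC addKr.
  rewrite enormZ gtr0_norm//.
  have := enorm_ge0 (w - (y + t *: v)).
  have : 0 <= (1 - r) * (t * enorm v).
    by rewrite !mulr_ge0 ?enorm_ge0 ?subr_ge0// ltW.
  lra.
apply: (@le_center_flat_ball _ _ f y) => // w; first by move/Sball/f_cont.
move=> u ws; apply: (flat_between ymin zmin t0) => //; first exact: Sball.
exact: ball.
Qed.

(** The flat balls around the points [y + a *: v] have a radius proportional to
    [a].  Hence [f] does not decrease along the points [y + (th ^+ k * t) *: v]
    with [th = 1 - r / 4], which converge to [y]. *)
Lemma minimizer_near_end y v t :
  minimizers f y -> minimizers f (y + v) ->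
  0 <= t -> t <= 1 / 2 -> 2 * (t * enorm v) <= delta ->
  minimizers f (y + t *: v).
Proof.
move=> ymin zmin; rewrite le_eqVlt => /orP[/eqP<-|t0 t12 tv].
  by rewrite scale0r addr0.
have [->|v0] := eqVneq v 0; first by rewrite scaler0 addr0.
have V : 0 < enorm v by rewrite enorm_gt0.
pose th := 1 - r / 4.
have th0 : 0 < th by rewrite /th; move: r_le1 r_gt0; lra.
have th1 : th < 1 by rewrite /th; move: r_gt0; lra.
have step a : 0 < a -> a <= t -> f (y + a *: v) <= f (y + (th * a) *: v).
  move=> a0 at_.
  have av : a * enorm v <= t * enorm v by rewrite ler_pM2r.
  have rav : 0 < r * (a * enorm v) by rewrite !mulr_gt0.
  apply: (@le_between y v a _ ymin zmin a0 _ _ _ (r * (a * enorm v) / 2)).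
  - exact: le_trans t12.
  - by lra.
  - by rewrite subrr enorm0 add0r.
  have -> : y + (th * a) *: v - (y + a *: v) = - ((r / 4 * a) *: v).
    by apply/rowP => i; rewrite !mxE /th; ring.
  rewrite enormN enormZ gtr0_norm ?mulr_gt0//; lra.
have th_n k : 0 < th ^+ k * t /\ th ^+ k * t <= t.
  split; first by rewrite mulr_gt0// exprn_gt0.
  by rewrite ler_piMl ?(ltW t0)// exprn_ile1 ?(ltW th0) ?(ltW th1).
have iter k : f (y + t *: v) <= f (y + (th ^+ k * t) *: v).
  elim: k => [|k IH]; first by rewrite expr0 mul1r.
  have [k0 kt] := th_n k.
  by apply: le_trans IH _; rewrite exprS -mulrA; exact: step.
suff : f (y + t *: v) <= f y by move=> H w; exact: le_trans H (ymin w).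
have Sy : S y by apply: (near_S ymin); rewrite subrr enorm0.
rewrite leNgt; apply/negP => fy.
have cvg_y : (y + (th ^+ k * t) *: v) @[k --> \oo] --> y.
  rewrite -[X in _ --> X](_ : y + (0 * t) *: v = y); last first.
    by rewrite mul0r scale0r addr0.
  apply: cvgD; first exact: cvg_cst.
  apply: cvgZ; last exact: cvg_cst.
  apply: cvgM; last exact: cvg_cst.
  by apply: cvg_expr; rewrite gtr0_norm.
have /cvg_y : nbhs y (fun w => f w < f (y + t *: v)).
  by apply: (cvgr_lt (f y) (f_cont Sy)).
move=> /= [k _ /(_ k (leqnn k))] /=.
by rewrite ltNge iter.
Qed.

(** Minimality has been propagated along a length [delta / 2] from an end point
    only; iterate from the point reached, by induction on the number of such
    lengths in the segment. *)
Lemma minimizers_convex y z t :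
  minimizers f y -> minimizers f z -> 0 <= t -> t <= 1 ->
  minimizers f (y + t *: (z - y)).
Proof.
move=> + zmin.
have [k] : exists k : nat, enorm (z - y) <= k%:R * (delta / 2).
  exists (Num.bound (enorm (z - y) / (delta / 2))).
  rewrite -ler_pdivrMr ?divr_gt0//; apply: ltW; apply: archi_boundP.
  by rewrite divr_ge0 ?enorm_ge0// ltW// divr_gt0.
elim: k y t => [|k IH] y t.
  rewrite mul0r => yz ymin _ _.
  have : enorm (z - y) == 0 by rewrite eq_le yz enorm_ge0.
  by rewrite enorm_eq0 => /eqP->; rewrite scaler0 addr0.
set v := z - y => yz ymin t0 t1.
have zE : z = y + v by rewrite /v addrC subrK.
have ymin' : minimizers f (y + v) by rewrite -zE.
have [vd|vd] := leP (enorm v) delta.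
  have [t12|t12] := leP t (1 / 2).
    apply: minimizer_near_end => //.
    by have := enorm_ge0 v => V; have := ler_wpM2r V t12; lra.
  have -> : y + t *: v = z + (1 - t) *: (- v).
    by rewrite zE; apply/rowP => i; rewrite !mxE; ring.
  apply: minimizer_near_end => //; [|lra|lra|].
    by rewrite zE addrK.
  rewrite enormN; have V := enorm_ge0 v.
  have t12' : 1 - t <= 1 / 2 by lra.
  by have := ler_wpM2r V t12'; lra.
have V : 0 < enorm v by exact: lt_trans vd.
pose t' := delta / 2 / enorm v.
have t'v : t' * enorm v = delta / 2 by rewrite /t' divfK// gt_eqF.
have t'0 : 0 < t' by rewrite !divr_gt0.
have t'12 : t' < 1 / 2 by rewrite ltr_pdivrMr//; lra.
have [tt|tt] := leP t t'.
  apply: minimizer_near_end => //; first lra.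
  by have := ler_wpM2r (ltW V) tt; lra.
have y'min : minimizers f (y + t' *: v).
  by apply: minimizer_near_end => //; [exact: ltW|exact: ltW|lra].
have zy' : z - (y + t' *: v) = (1 - t') *: v.
  by rewrite zE; apply/rowP => i; rewrite !mxE; ring.
have -> : y + t *: v =
    (y + t' *: v) + ((t - t') / (1 - t')) *: (z - (y + t' *: v)).
  rewrite zy' scalerA divfK; last by rewrite gt_eqF//; lra.
  by apply/rowP => i; rewrite !mxE; ring.
have t'1 : 0 < 1 - t' by lra.
apply: IH => //.
- rewrite zy' enormZ gtr0_norm// mulrBl mul1r t'v.
  by move: yz; rewrite mulrSr; lra.
- by rewrite divr_ge0 ?ltW// subr_gt0.
- by rewrite ler_pdivrMr//; lra.
Qed.

(** Every point [x] of the ball is the center of a flat ball that contains the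
    minimizer [y + t *: v]. *)
Lemma minimizers_ball y v t x :
  minimizers f y -> minimizers f (y + v) ->
  0 < t -> t <= 1 / 2 -> 2 * (t * enorm v) <= delta ->
  enorm (x - (y + t *: v)) < r * (t * enorm v) / 4 -> minimizers f x.
Proof.
move=> ymin zmin t0 t12 tv xb.
suff : f x <= f (y + t *: v).
  move=> H w; apply: le_trans H _.
  exact: (minimizer_near_end ymin zmin (ltW t0) t12 tv).
apply: (@le_between y v t _ ymin zmin t0 t12 tv _ (r * (t * enorm v) / 4)).
  by lra.
by rewrite enormBC.
Qed.

(** Let [e = x - c] for a point [x] just outside the ball.  Apply
    [minimizers_ball] to the chord of half-length [l] orthogonal to [e] whose
    midpoint is at distance [tau = rho - r * l / 8] from [c] towards [x].  Its
    end points are in the ball since [tau^2 + l^2 < rho^2] for small [l], and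
    the ball of radius [r * l / 4] around its midpoint reaches [r * l / 8]
    outside.
    This gain does not decrease when [rho] grows. *)
Lemma minimizers_ball_grow c rho l :
  (forall e : 'rV[R]_n, exists2 h : 'rV[R]_n, h != 0 & inner e h = 0) ->
  0 < l -> 2 * l <= delta -> 8 * l <= rho * r ->
  (forall x, enorm (x - c) < rho -> minimizers f x) ->
  forall x, enorm (x - c) < rho + r * l / 8 -> minimizers f x.
Proof.
move=> perp l0 ld lrho rho_min x xc.
have rl : 0 < r * l by rewrite mulr_gt0.
have [|rho_le] := ltP (enorm (x - c)) rho; first exact: rho_min.
have rho0 : 0 < rho by rewrite -(pmulr_lgt0 _ r_gt0); lra.
have [e eE] : exists e, e = x - c by exists (x - c).
rewrite -eE in xc rho_le.
have e0 : 0 < enorm e by exact: lt_le_trans rho_le.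
have [h [h1 eh]] : exists h, enorm h = 1 /\ inner e h = 0.
  have [h h0 eh] := perp e.
  exists ((enorm h)^-1 *: h); split; last by rewrite innerZr eh mulr0.
  have h0' : 0 < enorm h by rewrite enorm_gt0.
  by rewrite enormZ gtr0_norm ?invr_gt0// mulVf// gt_eqF.
pose tau := rho - r * l / 8; pose a := tau / enorm e.
have ae : a * enorm e = tau by rewrite /a divfK// gt_eqF.
have side m : m ^+ 2 = l ^+ 2 -> minimizers f (c + a *: e + m *: h).
  move=> ml; apply: rho_min.
  rewrite -(@ltr_pXn2r _ 2)// ?nnegrE ?enorm_ge0 ?ltW//.
  have -> : c + a *: e + m *: h - c = a *: e + m *: h.
    by apply/rowP => i; rewrite !mxE; ring.
  have -> : enorm (a *: e + m *: h) ^+ 2 = (a * enorm e) ^+ 2 + m ^+ 2.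
    rewrite sqr_enorm !innerE (innerC h e) eh -!sqr_enorm h1 exprMn sqr_enorm.
    by ring.
  rewrite ae ml /tau.
  have l2 := ler_wpM2l (ltW l0) lrho.
  have r2 : (r * l) ^+ 2 <= l ^+ 2.
    by rewrite ler_pXn2r ?nnegrE ?(ltW rl) ?(ltW l0)// ler_piMl ?(ltW l0).
  have l20 : 0 < l ^+ 2 by rewrite exprn_gt0.
  lra.
have E1 : c + a *: e + l *: h = (c + a *: e + (- l) *: h) + (2 * l) *: h.
  by apply/rowP => i; rewrite !mxE; ring.
have := side (- l); rewrite sqrrN => /(_ erefl) ymin.
have := side l erefl; rewrite E1 => zmin.
have v1 : enorm ((2 * l) *: h) = 2 * l.
  by rewrite enormZ h1 mulr1 gtr0_norm// mulr_gt0.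
apply: (minimizers_ball (t := 1 / 2) ymin zmin); rewrite ?v1; [lra|lra|lra|].
have -> : x - (c + a *: e + (- l) *: h + (1 / 2) *: ((2 * l) *: h)) =
    (1 - a) *: e.
  by apply/rowP => i; rewrite eE !mxE; field.
have a1 : 0 <= 1 - a.
  by rewrite subr_ge0 /a ler_pdivrMr// mul1r /tau; lra.
by rewrite enormZ ger0_norm// mulrBl mul1r ae /tau; lra.
Qed.

Lemma minimizers_everywhere y z :
  (forall e : 'rV[R]_n, exists2 h : 'rV[R]_n, h != 0 & inner e h = 0) ->
  minimizers f y -> minimizers f z -> y != z -> forall x, minimizers f x.
Proof.
move=> perp ymin zmin yz x.
pose v := z - y.
have v0 : 0 < enorm v by rewrite enorm_gt0 subr_eq0 eq_sym.
have zmin' : minimizers f (y + v) by rewrite /v addrC subrK.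
pose t := Num.min (1 / 2) (delta / 2 / enorm v).
have t0 : 0 < t by rewrite /t lt_min !divr_gt0.
have t12 : t <= 1 / 2 by rewrite /t ge_min lexx.
have tv : 2 * (t * enorm v) <= delta.
  have : t * enorm v <= delta / 2 by rewrite -ler_pdivlMr// /t ge_min lexx orbT.
  by lra.
pose c := y + t *: v; pose rho := r * (t * enorm v) / 4.
have rho0 : 0 < rho by rewrite /rho !(mulr_gt0, divr_gt0).
pose l := Num.min (rho * r / 8) (delta / 2).
have l0 : 0 < l by rewrite /l lt_min !(mulr_gt0, divr_gt0).
have ld : 2 * l <= delta.
  have : l <= delta / 2 by rewrite /l ge_min lexx orbT.
  by lra.
have lrho : 8 * l <= rho * r.
  have : l <= rho * r / 8 by rewrite /l ge_min lexx.
  by lra.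
have rl : 0 < r * l / 8 by rewrite !(mulr_gt0, divr_gt0).
have grow k : forall x, enorm (x - c) < rho + k%:R * (r * l / 8) ->
    minimizers f x.
  elim: k => [|k IH] w.
    rewrite mul0r addr0; exact: minimizers_ball.
  rewrite mulrSr mulrDl mul1r addrA; apply: minimizers_ball_grow => //.
  apply: le_trans lrho _; rewrite ler_pM2r// lerDl mulr_ge0//; exact: ltW.
apply: (grow (Num.bound (enorm (x - c) / (r * l / 8)))).
have : enorm (x - c) / (r * l / 8) <
    (Num.bound (enorm (x - c) / (r * l / 8)))%:R.
  by apply: archi_boundP; rewrite divr_ge0 ?enorm_ge0// ltW.
by rewrite ltr_pdivrMr//; lra.
Qed.

End Sharp.

(** On the line this fails, and an interval of minimizers is possible there. *)
Lemma exists_orthogonal (R : realType) n (e : 'rV[R]_n.+2) :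
  exists2 h : 'rV[R]_n.+2, h != 0 & inner e h = 0.
Proof.
have [e0|e0] := eqVneq (e ord0 ord0) 0.
  exists (delta_mx ord0 ord0).
    by apply/eqP => /rowP/(_ ord0)/eqP; rewrite !mxE !eqxx/= oner_eq0.
  rewrite /inner big_ord_recl big1 ?mxE ?e0 ?mul0r ?addr0// => i _.
  by rewrite !mxE eqxx/= mulr0.
pose h : 'rV[R]_n.+2 := e ord0 ord0 *: delta_mx ord0 (lift ord0 ord0)
  - e ord0 (lift ord0 ord0) *: delta_mx ord0 ord0.
exists h.
  apply: contra_neq e0 => /rowP/(_ (lift ord0 ord0)).
  by rewrite !mxE !eqxx/= mulr1 mulr0 subr0.
rewrite /inner !big_ord_recl big1 => [|i _]; rewrite !mxE ?eqxx/=.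
  ring.
by ring.
Qed.

(** * The region and the inverse condition number *)

Section Region.
Context {R : realType} {n : nat}.
Variable f : 'rV[R]_n -> R.
Implicit Types (x y z u v : 'rV[R]_n).

Lemma lipschitz_continuous_over (S : set 'rV[R]_n) x :
  locally_lipschitz_over f S -> S x -> {for x, continuous f}.
Proof.
move=> lip /lip[U [oU Ux [L fL]]].
apply/(@cvgrPdist_lt _ _ _ (nbhs x)) => e e0.
have L1 : 0 < `|L| + 1 by rewrite ltr_wpDl.
have nU : nbhs x U by exact: open_nbhs_nbhs.
have nB : nbhs x (fun y => enorm (y - x) < e / (`|L| + 1)).
  by apply: enorm_ball_nbhs; rewrite divr_gt0.
apply: filterS (filterI nU nB) => y [Uy yx].
apply: le_lt_trans (fL x y Ux Uy) _; rewrite enormBC.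
move: yx; rewrite ltr_pdivlMr// => yx.
apply: le_lt_trans yx; rewrite mulrC ler_wpM2l ?enorm_ge0//.
by have := ler_norm L; lra.
Qed.

Lemma edistance_le x y (X : set 'rV[R]_n) :
  X y -> (edistance x X <= (enorm (x - y))%:E)%E.
Proof. by move=> Xy; apply: ereal_inf_lbound; exists y. Qed.

Lemma region_closer x0 x :
  (forall y, minimizers f y -> enorm (x - y) <= enorm (x0 - y)) ->
  region f x0 x.
Proof.
move=> H; apply: le_ereal_inf_tmp => _ [y ymin <-].
by apply: le_trans (edistance_le x ymin) _; rewrite lee_fin H.
Qed.

(** By continuity at [x0]. In particular the region contains a neighbourhood of
    fixed size of each minimizer. *)
Lemma minimizers_separated x0 m :
  {for x0, continuous f} -> minimizers f m -> ~ minimizers f x0 ->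
  exists2 delta, 0 < delta &
    forall y, minimizers f y -> delta <= enorm (x0 - y).
Proof.
move=> cf mmin x0n.
have fm : f m < f x0.
  by rewrite ltNge; apply/negP => H; apply: x0n => y; exact: le_trans (mmin y).
have /nbhs_ballP[e /= e0 eb] : nbhs x0 (fun y => f m < f y).
  exact: (cvgr_gt (f x0) cf).
exists e => // y ymin; rewrite leNgt; apply/negP => x0y.
have : f m < f y.
  (* the library ball is the one of the sup norm, which [enorm] dominates *)
  apply: eb; split=> // i j; rewrite ord1 -ball_normE/=.
  by have := coord_le_enorm (x0 - y) j; rewrite !mxE => /le_lt_trans; exact.
by rewrite ltNge ymin.
Qed.

Lemma inverse_condition_numberP x0 (r : R) x y u :
  (r%:E <= inverse_condition_number f x0)%E ->
  minimizers f y -> region f x0 x -> ~ minimizers f x ->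
  clarke_subdiff f x u -> u != 0 ->
  r * (enorm u * enorm (x - y)) <= inner u (x - y).
Proof.
move=> rmu ymin Sx nx ux u0.
have u_gt0 : 0 < enorm u by rewrite enorm_gt0.
have xy_gt0 : 0 < enorm (x - y).
  by rewrite enorm_gt0 subr_eq0; apply: contra_notN nx => /eqP->.
rewrite -ler_pdivlMr ?mulr_gt0// -lee_fin; apply: le_trans rmu _.
apply: (@le_trans _ _ (ereal_inf [set (inner u0 ((y, x).2 - (y, x).1) /
    (enorm u0 * enorm ((y, x).2 - (y, x).1)))%:E
    | u0 in clarke_subdiff f (y, x).2 `\ 0])).
  by apply: ereal_inf_lbound; exists (y, x).
apply: ereal_inf_lbound; exists u => //; split => //=.
exact/eqP.
Qed.

End Region.

(** The structure of the set of minimizers that the runs rely on. *)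
Lemma minimizers_convex_unique (R : realType) n (f : 'rV[R]_n -> R)
    (x0 xs : 'rV[R]_n) (r : R) :
  locally_lipschitz_over f (region f x0) ->
  minimizers f xs -> ~ minimizers f x0 ->
  0 < r -> r <= 1 -> (r%:E <= inverse_condition_number f x0)%E ->
  (forall y z t, minimizers f y -> minimizers f z -> 0 <= t -> t <= 1 ->
     minimizers f (y + t *: (z - y))) /\
  ((1 < n)%N -> forall y, minimizers f y -> y = xs).
Proof.
move=> lip xsmin x0n r0 r1 rmu.
have Sx0 : region f x0 x0 by apply: region_closer.
have cf x : region f x0 x -> {for x, continuous f}.
  exact: lipschitz_continuous_over.
have [delta d0 sep] := minimizers_separated (cf _ Sx0) xsmin x0n.
have near_S x y : minimizers f y -> enorm (x - y) < delta -> region f x0 x.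
  move=> ymin xy; apply: le_trans (edistance_le x ymin) _.
  apply: le_ereal_inf_tmp => _ [z zmin <-]; rewrite lee_fin.
  by apply: le_trans (ltW xy) _; exact: sep.
have sharp x y u := @inverse_condition_numberP _ _ f x0 r x y u rmu.
split; first exact: (minimizers_convex cf d0 near_S r0 r1 sharp).
case: n => [//|[//|n]] in f x0 xs lip xsmin x0n rmu Sx0 cf sep near_S sharp *.
move=> _ y ymin; apply/eqP/negPn/negP => yxs; apply: x0n.
exact: (minimizers_everywhere cf d0 near_S r0 r1 sharp
  (@exists_orthogonal R n) ymin xsmin yxs).
Qed.

(** * The line *)

Section Line.
Context {R : realType}.
Implicit Types (u v : 'rV[R]_1) (a b s : R).

Lemma inner_line u v : inner u v = u ord0 ord0 * v ord0 ord0.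
Proof. by rewrite /inner big_ord1. Qed.

Lemma enorm_line u : enorm u = `|u ord0 ord0|.
Proof. by rewrite /enorm inner_line -expr2 sqrtr_sqr. Qed.

(** Moving from [a] towards the origin by [s]: either the origin is not passed,
    or it is passed by at most [|s|]. *)
Lemma line_backward a s : 0 <= s * a -> `|a - s| <= Num.max `|a| `|s|.
Proof.
rewrite le_max => sa.
have [a0|a0] := ltP 0 a; have [s0|s0] := ltP 0 s.
- rewrite (gtr0_norm a0) (gtr0_norm s0) !ler_norml; apply/orP.
  by case: (leP s a) => ?; [left|right]; lra.
- have s00 : s = 0.
    by apply/eqP; rewrite eq_le s0/= -(pmulr_lge0 _ a0).
  by rewrite s00 subr0 lexx.
- have a00 : a = 0.
    by apply/eqP; rewrite eq_le a0/= -(pmulr_rge0 _ s0).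
  by rewrite a00 sub0r normrN lexx orbT.
- rewrite (ler0_norm a0) (ler0_norm s0) !ler_norml; apply/orP.
  by case: (leP s a) => ?; [right|left]; apply/andP; split; lra.
Qed.

End Line.

(** * The subgradient method *)

Section Rate.
Context {R : realType}.
Variable r : R.
Hypothesis r_sqr : 2 * r ^+ 2 <= 1.

Definition rate (t : nat) : R := (1 - r ^+ 2) `^ (t%:R / 2).

Lemma sqr_rate t : rate t ^+ 2 = (1 - r ^+ 2) ^+ t.
Proof.
have a0 : 0 <= 1 - r ^+ 2 by move: r_sqr; have := sqr_ge0 r; lra.
by rewrite /rate -powR_mulrn ?powR_ge0// -powRrM divfK// powR_mulrn.
Qed.

Lemma rate_ge0 t : 0 <= rate t. Proof. exact: powR_ge0. Qed.

Lemma rate0 : rate 0 = 1. Proof. by rewrite /rate mul0r powRr0. Qed.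

Lemma rate_le1 t : rate t <= 1.
Proof.
rewrite -(@ler_pXn2r _ 2)// ?nnegrE ?rate_ge0// sqr_rate expr1n.
by apply: exprn_ile1; move: r_sqr (sqr_ge0 r); lra.
Qed.

End Rate.

Section Run.
Context {R : realType} {n : nat}.
Variables (f : 'rV[R]_n -> R) (x0 xs : 'rV[R]_n) (r : R).
Variables (T : nat) (x g : nat -> 'rV[R]_n).
Hypothesis xs_min : minimizers f xs.
Hypothesis r_gt0 : 0 < r.
Hypothesis r_sqr : 2 * r ^+ 2 <= 1.
Hypothesis run : subgradient_run f r x0 xs T x g.
Hypothesis sharp : forall x y u, minimizers f y -> region f x0 x ->
  ~ minimizers f x -> clarke_subdiff f x u -> u != 0 ->
  r * (enorm u * enorm (x - y)) <= inner u (x - y).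

Definition displacement (t : nat) : 'rV[R]_n :=
  (r * rate r t * enorm (x0 - xs) / enorm (g t)) *: g t.

Lemma run_next t : (t < T)%N ->
  [/\ ~ minimizers f (x t), clarke_subdiff f (x t) (g t), g t != 0,
      x t.+1 = x t - displacement t &
      enorm (displacement t) = r * rate r t * enorm (x0 - xs)].
Proof.
have [_ H] := run; move=> /H /= [n0 gt xt].
have g0 : g t != 0 by apply: contra_notN n0 => /eqP <-.
split => //; first by move=> /clarke_subdiff_minimizer.
rewrite /displacement enormZ ger0_norm ?divfK ?enorm_eq0//.
by rewrite divr_ge0 ?enorm_ge0// !mulr_ge0 ?enorm_ge0 ?rate_ge0// ltW.
Qed.

Lemma sharp_displacement t y :
  (t < T)%N -> region f x0 (x t) -> minimizers f y ->
  r * (enorm (displacement t) * enorm (x t - y)) <=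
  inner (displacement t) (x t - y).
Proof.
move=> /run_next[nx gx g0 _ _] Sx ymin.
rewrite /displacement enormZ innerZl; set eta := _ / _.
have eta0 : 0 <= eta.
  by rewrite divr_ge0 ?enorm_ge0// !mulr_ge0 ?enorm_ge0 ?rate_ge0// ltW.
rewrite ger0_norm// -(mulrA eta) mulrCA.
by rewrite ler_wpM2l//; exact: sharp.
Qed.

(** The membership of the iterates in the region is left as a hypothesis,
    because the reasons for it depend on the dimension. *)
Lemma run_bound :
  (forall t, (t < T)%N -> enorm (x t - xs) <= enorm (x0 - xs) ->
    region f x0 (x t)) ->
  forall t, (t <= T)%N -> enorm (x t - xs) <= rate r t * enorm (x0 - xs).
Proof.
move=> inS; elim=> [|t IH] tT.
  by have [-> _] := run; rewrite rate0 mul1r.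
have {}IH := IH (ltnW tT).
have D0 := enorm_ge0 (x0 - xs).
have Sx : region f x0 (x t).
  by apply: inS => //; apply: le_trans IH _; rewrite ler_piMl ?rate_le1.
have H := sharp_displacement tT Sx xs_min.
have [_ _ _ xE sE] := run_next tT.
rewrite -(@ler_pXn2r _ 2)// ?nnegrE ?mulr_ge0 ?enorm_ge0 ?rate_ge0//.
have -> : (rate r t.+1 * enorm (x0 - xs)) ^+ 2 =
    (1 - r ^+ 2) * (rate r t * enorm (x0 - xs)) ^+ 2.
  by rewrite !exprMn !sqr_rate// exprS; ring.
have -> : enorm (x t.+1 - xs) ^+ 2 =
    enorm (x t - xs) ^+ 2 - 2 * inner (displacement t) (x t - xs) +
    enorm (displacement t) ^+ 2.
  by rewrite xE addrAC; exact: sqr_enormB.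
rewrite sE -(mulrA r) in H *.
set E := rate r t * _ in IH H *; set d := enorm (x t - xs) in IH H *.
have d0 : 0 <= d by exact: enorm_ge0.
(* this product is [(1 - r^2) E^2] minus [d^2 - 2 r (r E) d + (r E)^2] *)
have : 0 <= (E - d) * (E + d - 2 * r ^+ 2 * E).
  rewrite mulr_ge0 ?subr_ge0//.
  have E0 : 0 <= E by exact: le_trans IH.
  by have := ler_wpM2r E0 r_sqr; lra.
by lra.
Qed.

End Run.

(** On the line, being sharp for every minimizer [y] means that the step points
    towards [y], so by [line_backward] the distance to [y] after a step is at
    most the maximum of the previous one and of the length of the step.  All
    the steps are at most [r * |x0 - xs|] long, and this is at most [|x0 - y|]
    for every minimizer [y] unless the first step lands between [y] and [xs],
    hence on a minimizer, where the run stops. *)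
Lemma run_line_in_region (R : realType) (f : 'rV[R]_1 -> R)
    (x0 xs : 'rV[R]_1) (r : R) (T : nat) (x g : nat -> 'rV[R]_1) :
  minimizers f xs -> 0 < r -> 2 * r ^+ 2 <= 1 ->
  subgradient_run f r x0 xs T x g ->
  (forall x y u, minimizers f y -> region f x0 x ->
    ~ minimizers f x -> clarke_subdiff f x u -> u != 0 ->
    r * (enorm u * enorm (x - y)) <= inner u (x - y)) ->
  (forall y z t, minimizers f y -> minimizers f z -> 0 <= t -> t <= 1 ->
    minimizers f (y + t *: (z - y))) ->
  forall t, (t < T)%N -> region f x0 (x t).
Proof.
move=> xsmin r0 r2 run sharp segment t tT; apply: region_closer.
have r1 : r < 1.
  rewrite ltNge; apply/negP => r1.
  by have := ler_pM ler01 ler01 r1 r1; lra.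
have xE0 : x 0%N = x0 by have [] := run.
have [s sdef] : exists s, forall t, displacement x0 xs r g t = s t.
  by exists (displacement x0 xs r g).
have align t' y : (t' < T)%N -> region f x0 (x t') -> minimizers f y ->
    0 <= s t' ord0 ord0 * (x t' - y) ord0 ord0.
  move=> t'T Sx ymin; rewrite -inner_line -sdef.
  apply: le_trans (sharp_displacement r0 run sharp t'T Sx ymin).
  by rewrite !mulr_ge0 ?enorm_ge0// ltW.
have Sx0 : region f x0 (x 0%N) by rewrite xE0; apply: region_closer.
have first_step y : (1 < T)%N -> minimizers f y ->
    r * enorm (x0 - xs) <= enorm (x0 - y).
  move=> T1 ymin; have T0 := ltnW T1.
  have [n1 _ _ _ _] := run_next r0 run T1.
  have [n0 _ _ xE sE] := run_next r0 run T0.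
  rewrite sdef xE0 rate0 mulr1 in xE sE.
  have ay := align 0%N y T0 Sx0 ymin; have axs := align 0%N xs T0 Sx0 xsmin.
  rewrite leNgt; apply/negP => ylt; apply: n1; rewrite xE.
  have D0 : 0 < enorm (x0 - xs).
    rewrite enorm_gt0 subr_eq0; apply: contra_notN n0 => /eqP x0xs.
    by rewrite xE0 x0xs.
  have D1 : r * enorm (x0 - xs) < enorm (x0 - xs) by rewrite gtr_pMl.
  (* [x 1] is [y + (num / den) *: (xs - y)] *)
  pose den := (xs - y) ord0 ord0.
  pose num := (x0 - s 0%N - y) ord0 ord0.
  have [den0 tau0 tau1] : [/\ den != 0, 0 <= num / den & num / den <= 1].
    rewrite -sE in ylt D1; rewrite !enorm_line in ylt D1 ay axs.
    rewrite xE0 in ay axs; rewrite /den /num; rewrite !mxE in ylt D1 ay axs *.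
    set a := x0 _ _ in ylt D1 ay axs *; set b := y _ _ in ylt D1 ay axs *.
    set c := xs _ _ in ylt D1 ay axs *; set w := s _ _ _ in ylt D1 ay axs *.
    have [w0|w0] := ltP 0 w.
      have ab : 0 <= a - b by rewrite -(pmulr_rge0 _ w0).
      have ac : 0 <= a - c by rewrite -(pmulr_rge0 _ w0).
      rewrite !ger0_norm ?(ltW w0)// in ylt D1.
      have cb : c - b < 0 by lra.
      split; first by rewrite lt_eqF.
        by rewrite ler_ndivlMr// mul0r; lra.
      by rewrite ler_ndivrMr// mul1r; lra.
    have w0' : w < 0.
      rewrite lt_neqAle w0 andbT; apply: contraTneq ylt => ->.
      by rewrite normr0 -leNgt normr_ge0.
    have ab : a - b <= 0 by rewrite -(nmulr_rge0 _ w0').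
    have ac : a - c <= 0 by rewrite -(nmulr_rge0 _ w0').
    rewrite !ler0_norm// in ylt D1.
    have cb : 0 < c - b by lra.
    split; first by rewrite gt_eqF.
      by rewrite ler_pdivlMr// mul0r; lra.
    by rewrite ler_pdivrMr// mul1r; lra.
  have -> : x0 - s 0%N = y + (num / den) *: (xs - y).
    apply/rowP => i; rewrite (ord1 i).
    have -> : (y + (num / den) *: (xs - y)) ord0 ord0 =
        y ord0 ord0 + num / den * den.
      by rewrite /den !mxE.
    by rewrite divfK// /num !mxE; ring.
  exact: segment.
elim: t tT => [|t IH] tT y ymin; first by rewrite xE0.
have tT' := ltnW tT; have {}IH := IH tT'.
have Sx : region f x0 (x t) by exact: region_closer.
have [_ _ _ -> sE] := run_next r0 run tT'; rewrite sdef in sE *.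
rewrite addrAC !enorm_line mxE [X in `|_ + X|]mxE.
apply: le_trans (line_backward (align _ _ tT' Sx ymin)) _.
rewrite ge_max -!enorm_line IH//= sE.
have T1 : (1 < T)%N by apply: leq_ltn_trans tT.
apply: le_trans (first_step y T1 ymin).
by rewrite ler_wpM2r ?enorm_ge0// ler_piMr ?rate_le1// ltW.
Qed.

Unset Implicit Arguments.

Theorem theorem6 (R : realType) (n : nat) (f : 'rV[R]_n -> R)
    (minimizers_nonempty : minimizers f !=set0)
    (x0 : 'rV[R]_n)
    (f_lipschitz : locally_lipschitz_over f (region f x0))
    (mu_gt0 : (0 < inverse_condition_number f x0)%E)
    (xs : 'rV[R]_n) (xs_minimizer : minimizers f xs)
    (r : R) (r_gt0 : 0 < r)
    (r_le : (r%:E <= Order.min (inverse_condition_number f x0)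
                               (1 / Num.sqrt 2)%:E)%E)
    (T : nat) (x g : nat -> 'rV[R]_n)
    (run : subgradient_run f r x0 xs T x g) :
  forall t : nat, (t <= T)%N ->
    enorm (x t - xs) <= (1 - r ^+ 2) `^ (t%:R / 2) * enorm (x0 - xs).
Proof.
have [r_mu r_sqrt] : (r%:E <= inverse_condition_number f x0)%E /\
    r <= 1 / Num.sqrt 2.
  by move: r_le; rewrite le_min lee_fin => /andP.
have r_sqr : 2 * r ^+ 2 <= 1.
  have s2 : 0 < Num.sqrt (2 : R) by rewrite sqrtr_gt0.
  move: r_sqrt; rewrite ler_pdivlMr// => H.
  have rs0 := mulr_ge0 (ltW r_gt0) (ltW s2).
  have := ler_pM rs0 rs0 H H.
  by rewrite mulr1 -expr2 exprMn sqr_sqrtr// mulrC.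
have r_le1 : r <= 1.
  rewrite leNgt; apply/negP => r1.
  by have := ler_pM ler01 ler01 (ltW r1) (ltW r1); lra.
have [xE0 _] := run.
have sharp x y u := @inverse_condition_numberP _ _ f x0 r x y u r_mu.
(* the method stops at once at a minimizer *)
have [x0min|x0n] := pselect (minimizers f x0).
  have T0 : T = 0%N.
    case: (posnP T) => // T0.
    by have [] := run_next r_gt0 run T0; rewrite xE0.
  move=> t; rewrite T0 leqn0 => /eqP ->.
  by rewrite mul0r powRr0 mul1r xE0.
have [segment single] :=
  minimizers_convex_unique f_lipschitz xs_minimizer x0n r_gt0 r_le1 r_mu.
apply: (run_bound xs_minimizer r_gt0 r_sqr run sharp) => t tT xt.
case: n => [|[|n]] in f minimizers_nonempty x0 f_lipschitz mu_gt0 xs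
  xs_minimizer r_le x g run r_mu xE0 sharp x0n segment single tT xt *.
(* in dimension 0, every point is a minimizer *)
- by case: x0n => y; rewrite (_ : x0 = y)//; apply/rowP => -[].
- exact: (run_line_in_region xs_minimizer r_gt0 r_sqr run sharp segment).
- by apply: region_closer => y ymin; rewrite (single isT y ymin).
Qed.
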